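(* For any integer $k\ge 1$ and any integer $n\ge 2k+2$, Thompson's group $F$ has pockets of depth at least $k$ with respect to the generating set $X_n=\{x_0,x_1,\dots,x_n\}$.
   Context: Thompson's group is $F=\langle x_k,\ k\ge 0\mid x_i^{-1}x_jx_i=x_{j+1}\text{ if } i<j\rangle$; for $n\ge 1$ the set $X_n=\{x_0,\dots,x_n\}$ generates $F$. Let $G$ be a group with finite generating set $S$, word length $|\cdot|_S$, and let $B_w(r)$ denote the ball of radius $r$ centered at $w$ in the Cayley graph $\Gamma(G,S)$ (where $h$ and $hs^{\pm 1}$, $s\in S$, are joined by an edge). An element $w\in G$ with $|w|_S=m$ is a $k$-pocket if $B_w(k)\subset B_{Id}(m)$, where $k$ is the maximal integer for which this is true. The integer $k$ is called the depth of the pocket. *)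

(* Defs.v *)
From HB Require Import structures.
From mathcomp Require Import all_boot.
From mathcomp Require Import boolp classical_sets.

Set Implicit Arguments.
Unset Strict Implicit.
Unset Printing Implicit Defensive.

Local Open Scope group_scope.
Local Open Scope classical_set_scope.
Local Open Scope quotient_scope.

Section PresentedGroup.
Variable I : choiceType.

(* The letter (i, true) stands for the generator i, and (i, false) for its
   inverse. *)
Definition word := seq (I * bool).

Definition inv_word (u : word) : word := [seq (a.1, ~~ a.2) | a <- rev u].

(* R u v means that u = v is one of the defining relations. *)
Variable R : word -> word -> Prop.

Inductive word_eqv : word -> word -> Prop :=
| WordRefl u : word_eqv u u
| WordSym u v : word_eqv u v -> word_eqv v u
| WordTrans u v w : word_eqv u v -> word_eqv v w -> word_eqv u w
| WordCat u u' v v' :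
    word_eqv u u' -> word_eqv v v' -> word_eqv (u ++ v) (u' ++ v')
| WordCancel i b : word_eqv [:: (i, b); (i, ~~ b)] [::]
| WordRel u v : R u v -> word_eqv u v.

Definition word_eqvb (u v : word) : bool := `[< word_eqv u v >].

Fact word_eqvb_refl : reflexive word_eqvb.
Proof. by move=> u; apply/asboolP; exact: WordRefl. Qed.

Fact word_eqvb_sym : symmetric word_eqvb.
Proof. by move=> u v; apply/asboolP/asboolP; exact: WordSym. Qed.

Fact word_eqvb_trans : transitive word_eqvb.
Proof.
by move=> v u w /asboolP uv /asboolP vw; apply/asboolP; exact: WordTrans uv vw.
Qed.

Canonical word_eqv_rel :=
  EquivRel word_eqvb word_eqvb_refl word_eqvb_sym word_eqvb_trans.

Definition presented := {eq_quot word_eqv_rel}.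
HB.instance Definition _ := Choice.on presented.
HB.instance Definition _ := EqQuotient.on presented.

Definition class (u : word) : presented := \pi_presented u.

Lemma classP (u v : word) : class u = class v <-> word_eqv u v.
Proof. by split=> [/eqquotP/asboolP|?] //; apply/eqquotP/asboolP. Qed.

Lemma class_repr (g : presented) : class (repr g) = g.
Proof. exact: reprK. Qed.

Definition pres_one : presented := class [::].
Definition pres_mul (g h : presented) : presented := class (repr g ++ repr h).
Definition pres_inv (g : presented) : presented := class (inv_word (repr g)).

Lemma pres_mulE u v : pres_mul (class u) (class v) = class (u ++ v).
Proof. by apply/classP/WordCat; apply/classP; rewrite class_repr. Qed.

Lemma word_eqv_catV u : word_eqv (u ++ inv_word u) [::].
Proof.
elim: u => [|[i b] u IH]; first exact: WordRefl.
rewrite /inv_word rev_cons map_rcons -cats1 /= -cat_cons -cat1s -!catA.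
apply: WordTrans (WordCancel i b).
apply: (WordCat (u := [:: _]) (u' := [:: _]) (v' := [:: _])).
  exact: WordRefl.
by rewrite catA; apply: (WordCat (u' := [::])) => //; exact: WordRefl.
Qed.

Lemma inv_wordK : involutive inv_word.
Proof.
move=> u; rewrite /inv_word -map_rev revK -map_comp -[RHS]map_id.
by apply: eq_map => -[i b] /=; rewrite negbK.
Qed.

Fact pres_mulA : associative pres_mul.
Proof.
move=> f g h; rewrite -(class_repr f) -(class_repr g) -(class_repr h).
by rewrite !pres_mulE catA.
Qed.

Fact pres_mul1 : left_id pres_one pres_mul.
Proof. by move=> g; rewrite -(class_repr g) pres_mulE. Qed.

Fact pres_mulr1 : right_id pres_one pres_mul.
Proof. by move=> g; rewrite -(class_repr g) pres_mulE cats0. Qed.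

Fact pres_mulV : left_inverse pres_one pres_inv pres_mul.
Proof.
move=> g; rewrite -[g in X in pres_mul _ X](class_repr g) pres_mulE.
by apply/classP; rewrite -{2}(inv_wordK (repr g)); exact: word_eqv_catV.
Qed.

Fact pres_mulrV : right_inverse pres_one pres_inv pres_mul.
Proof.
move=> g; rewrite -[g in X in pres_mul X _](class_repr g) pres_mulE.
by apply/classP; exact: word_eqv_catV.
Qed.

HB.instance Definition _ := isGroup.Build presented
  pres_mulA pres_mul1 pres_mulr1 pres_mulV pres_mulrV.

Definition generator (i : I) : presented := class [:: (i, true)].

End PresentedGroup.

Section WordMetric.
Variables (G : groupType) (S : seq G).

Definition is_letter (x : G) : bool := has (fun s => (x == s) || (x == s^-1)) S.

Definition spells (p : seq G) (g : G) : Prop :=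
  all is_letter p /\ \prod_(x <- p) x = g.

(* |g|_S = m; no such m exists when g is not in the subgroup generated by S. *)
Definition word_length (g : G) (m : nat) : Prop :=
  (exists2 p, spells p g & size p = m) /\
  (forall p, spells p g -> m <= size p).

Definition cayley_edge : rel G :=
  fun g h => has (fun s => (h == g * s) || (h == g * s^-1)) S.

Definition ball (w : G) (r : nat) : set G :=
  [set g | exists p : seq G,
     [/\ path cayley_edge w p, last w p = g & size p <= r]].

Definition is_pocket (k : nat) (w : G) : Prop :=
  exists m, [/\ word_length w m,
                ball w k `<=` ball 1 m
              & forall k', ball w k' `<=` ball 1 m -> k' <= k].

End WordMetric.

Inductive thompson_rel : word nat -> word nat -> Prop :=
| ThompsonRel i j : i < j ->
    thompson_rel [:: (i, false); (j, true); (i, true)] [:: (j.+1, true)].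

Definition thompsonF : groupType := presented thompson_rel.

Definition thompson_x (i : nat) : thompsonF := generator thompson_rel i.

Definition thompson_X (n : nat) : seq thompsonF :=
  [seq thompson_x i | i <- iota 0 n.+1].

Lemma thompson_xJ i j : i < j ->
  (thompson_x i)^-1 * thompson_x j * thompson_x i = thompson_x j.+1.
Proof.
move=> ij; have xV : (thompson_x i)^-1 = class thompson_rel [:: (i, false)].
  apply: (@mulgI _ (thompson_x i)); rewrite mulgV.
  rewrite [RHS]pres_mulE; apply/esym/classP; exact: (WordCancel _ i true).
rewrite xV [X in X * _]pres_mulE [LHS]pres_mulE; apply/classP/WordRel.
exact: ThompsonRel.
Qed.

(* Main.v *)
Require Import Defs.
From mathcomp Require Import all_boot zify.
From mathcomp Require Import boolp classical_sets.

(** Forests give the intuition.  Reading a word from left to right, the letter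
    x_i splits the i-th tree of a forest into its two subtrees and x_i^-1 joins
    the trees i and i+1 under a new caret, so an element of F is a pair of
    forests on the same leaves, the one that is taken apart and the one that
    is built.  With all the generators at hand, the cheapest route between two
    forests without common carets takes one letter for each caret.  With x_0,
    ..., x_n only, the trees at positions beyond n are out of reach, and the
    only remedy is to join trees further to the left and to split them again
    later: each such penalty caret costs two extra letters.

    The pocket.  Take r consecutive left combs, rebuild each of them as a tree
    of the same size in which all leaves have depth at least k, and moreover
    join the trees M and M+1, where M = n + K with K large.  The last caret
    forces K penalty carets, whence a length 2K + 1 + 2rL, for combs of L
    carets.  From this element a split removes a caret, because the trees are
    deep enough for k splits in succession, and a join adds a caret but spares
    a penalty caret.  So no k letters can increase the length.

    Upper bound ([pocket_upper]).  Write k letters as p q^-1, with p and q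
    products of s and t generators.  Then p cancels against the deep trees,
    and q joins the result into a forest Q with t - s more carets
    ([forest_split], [forest_merge]).  If t <= s, join all combs with K
    penalty carets, make the caret M and then go from right to left,
    otherwise join the trees of Q instead, which takes only K - (t - s)
    penalty carets.  In both cases one side of the forest pair is a single
    tree, to be taken apart from right to left (in the second case after
    inversion) with letters of index less than n, which is where n >= 2k + 2
    enters ([forest_lump]); the carets of the other side can be inserted as
    soon as they come within reach, at no extra cost ([within_slide]).

    Lower bound ([pocket_lower]).  F acts on the gaps between adjacent leaves
    (the type [cut]): a gap is open when it separates two trees, and otherwise
    it belongs to a caret.  A letter opens or closes exactly one gap
    ([sum_toggles]), so it suffices to bound from below how often each gap
    changes.  The gaps inside the combs change at least twice, for otherwise
    the subtree at the gap would survive ([toggles_ge2]).  When the gap M+1 is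
    closed, by a letter of index at most n, at most n of the gaps 1, ..., M
    are open, so the other ones, K in number at least, change at least twice
    as well ([pocket_toggles_open]).

    Since F has elements of any length, the depth of the pocket is finite. *)

Set Implicit Arguments.
Unset Strict Implicit.
Unset Printing Implicit Defensive.

Local Open Scope group_scope.

Notation x := thompson_x.

Local Arguments thompson_X : simpl never.
Local Arguments cayley_edge : simpl never.

(** * Words and word length *)

Definition letter (a : nat * bool) : thompsonF :=
  if a.2 then x a.1 else (x a.1)^-1.

Definition eval (v : word nat) : thompsonF := \prod_(a <- v) letter a.

Definition pos (l : seq nat) : thompsonF := \prod_(i <- l) x i.

Lemma eval_cat u v : eval (u ++ v) = eval u * eval v.
Proof. exact: big_cat. Qed.

Lemma pos_cons i l : pos (i :: l) = x i * pos l.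
Proof. exact: big_cons. Qed.

Lemma pos_cat l1 l2 : pos (l1 ++ l2) = pos l1 * pos l2.
Proof. exact: big_cat. Qed.

Lemma pos_rcons l i : pos (rcons l i) = pos l * x i.
Proof. by rewrite -cats1 pos_cat /pos big_seq1. Qed.

Lemma eval_pos l : eval [seq (i, true) | i <- l] = pos l.
Proof. by rewrite /eval big_map. Qed.

Lemma x_shift i j : i < j -> x j * x i = x i * x j.+1.
Proof. by move/thompson_xJ <-; rewrite -!mulgA mulVKg. Qed.

Lemma xV_shift i j : i < j -> x i * (x j.+1)^-1 = (x j)^-1 * x i.
Proof.
move=> ij; apply: (mulgI (x j)); apply: (mulIg (x j.+1)).
by rewrite mulVKg mulgA mulgVK; exact: x_shift.
Qed.

Lemma letter_class a : letter a = class thompson_rel [:: a].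
Proof.
case: a => i [] //; rewrite /letter /=; apply: (@mulgI _ (x i)); rewrite mulgV.
rewrite [RHS]pres_mulE; apply/esym/classP; exact: (WordCancel _ i true).
Qed.

Lemma class_eval v : class thompson_rel v = eval v.
Proof.
elim: v => [|a v IH]; first by rewrite /eval big_nil.
by rewrite /eval big_cons -/(eval v) -IH letter_class [RHS]pres_mulE.
Qed.

Definition within n (g : thompsonF) m :=
  exists v : word nat, [/\ all (fun a => a.1 <= n) v, eval v = g & size v <= m].

Lemma withinM n g h a b :
  within n g a -> within n h b -> within n (g * h) (a + b).
Proof.
move=> [u [un <- ua]] [v [vn <- vb]]; exists (u ++ v).
by rewrite all_cat un vn eval_cat size_cat leq_add.
Qed.

Lemma withinV n g a : within n g a -> within n g^-1 a.
Proof.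
move=> [u [un <- ua]]; exists [seq (l.1, ~~ l.2) | l <- rev u].
rewrite size_map size_rev; split=> //; first by rewrite all_map all_rev.
rewrite /eval -[in RHS](revK u) -prodgV big_map.
apply: eq_bigr => -[i []] _ //=.
by rewrite /letter /= invgK.
Qed.

Lemma within_pos n l : all (fun i => i <= n) l -> within n (pos l) (size l).
Proof.
move=> ln; exists [seq (i, true) | i <- l].
by rewrite size_map all_map /eval big_map.
Qed.

Lemma within_leq n g a b : a <= b -> within n g a -> within n g b.
Proof.
by move=> ab [u [un ug ua]]; exists u; split=> //; exact: leq_trans ab.
Qed.

Lemma letter_in_X n a : a.1 <= n -> is_letter (thompson_X n) (letter a).
Proof.
move=> an; apply/hasP; exists (x a.1).
  by apply: map_f; rewrite mem_iota add0n ltnS an.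
by rewrite /letter; case: a.2; rewrite eqxx ?orbT.
Qed.

Lemma X_letter n g : is_letter (thompson_X n) g ->
  exists2 a, a.1 <= n & g = letter a.
Proof.
case/hasP=> s /mapP[i]; rewrite mem_iota add0n ltnS => /andP[_ le_in] ->.
by case/orP=> /eqP->; [exists (i, true) | exists (i, false)].
Qed.

Lemma spells_eval n p g : spells (thompson_X n) p g ->
  exists v : word nat,
    [/\ all (fun a => a.1 <= n) v, eval v = g & size v = size p].
Proof.
case=> pX <-; elim: p pX => [|y p IH] /=.
  by exists [::]; rewrite /eval !big_nil.
case/andP=> /X_letter[a an ->] /IH[v [vn vp vs]]; exists (a :: v).
by rewrite /= an vn vs /eval !big_cons -vp.
Qed.

Lemma eval_spells n v : all (fun a => a.1 <= n) v ->
  spells (thompson_X n) [seq letter a | a <- v] (eval v).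
Proof.
move=> vn; split; last by rewrite big_map.
by rewrite all_map; apply: sub_all vn => a; exact: letter_in_X.
Qed.

Lemma edge_letter n g h :
  cayley_edge (thompson_X n) g h = is_letter (thompson_X n) (g^-1 * h).
Proof.
apply: eq_has => s /=; congr (_ || _).
  by apply/eqP/eqP => [->|<-]; rewrite ?mulKg ?mulVKg.
by apply/eqP/eqP => [->|<-]; rewrite ?mulKg ?mulVKg.
Qed.

Lemma ballP n (w g : thompsonF) r :
  ball (thompson_X n) w r g <-> within n (w^-1 * g) r.
Proof.
split=> [[p [pw <- pr]]|[v [vn vg vr]]].
  apply: within_leq pr _; elim: p w pw => [|h p IH] w /=.
    by rewrite mulVg; exists [::]; rewrite /eval big_nil.
  rewrite edge_letter => /andP[/X_letter[a an wh] /IH].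
  case=> v [vn vh vs]; exists (a :: v); rewrite /= an vn; split=> //.
  by rewrite /eval big_cons -wh -/(eval v) vh -mulgA mulVKg.
have -> : g = w * eval v by rewrite vg mulVKg.
exists (scanl (fun h a => h * letter a) w v); rewrite size_scanl; split=> //.
  elim: v w vn {vg vr} => //= a v IH w /andP[an vn].
  by rewrite edge_letter mulKg letter_in_X //= IH.
elim: v w {vn vg vr} => [|a v IH] w /=; first by rewrite /eval big_nil mulg1.
by rewrite IH /eval big_cons mulgA.
Qed.

(** * Forests as positive words *)

Inductive tree := leaf | node of tree & tree.

Fixpoint carets t := if t is node l r then (carets l + carets r).+1%N else 0.

(** The largest number of right turns on the way to a leaf.  When a tree is
    taken apart from right to left, the trees to the left of the current one
    come from its left siblings, one for each right turn, so this bounds the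
    indices of the letters ([tree_word_lt]). *)
Fixpoint rdepth t := if t is node l r then maxn (rdepth l) (rdepth r).+1 else 0.

(** The depth of the highest leaf: this many successive splits are possible. *)
Fixpoint depth t := if t is node l r then (minn (depth l) (depth r)).+1 else 0.

(** The word that takes apart the tree at position i.  The right subtree comes
    first, so that its leaves do not displace the left subtree. *)
Fixpoint tree_word i t :=
  if t is node l r then i :: tree_word i.+1 r ++ tree_word i l else [::].

Fixpoint forest_word i ts :=
  if ts is t :: ts' then forest_word i.+1 ts' ++ tree_word i t else [::].

Definition fcarets ts := sumn [seq carets t | t <- ts].

Lemma size_tree_word i t : size (tree_word i t) = carets t.
Proof.
elim: t i => //= l IHl r IHr i.
by rewrite size_cat IHl IHr addnC.
Qed.

Lemma tree_word_ge i t : all (fun a => i <= a) (tree_word i t).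
Proof.
elim: t i => //= l IHl r IHr i; rewrite leqnn all_cat IHl andbT /=.
by apply: sub_all (IHr i.+1) => a; exact: ltnW.
Qed.

Lemma forest_word_ge i ts : all (fun a => i <= a) (forest_word i ts).
Proof.
elim: ts i => //= t ts IH i; rewrite all_cat tree_word_ge andbT.
by apply: sub_all (IH i.+1) => a; exact: ltnW.
Qed.

Lemma tree_word_lt i t : all (fun a => a < i + rdepth t) (tree_word i t).
Proof.
elim: t i => //= l IHl r IHr i; rewrite all_cat; apply/and3P; split; first lia.
  by apply: sub_all (IHr i.+1) => a; lia.
by apply: sub_all (IHl i) => a; lia.
Qed.

Lemma tree_word_shift c i t :
  tree_word (i + c) t = [seq (a + c)%N | a <- tree_word i t].
Proof.
elim: t i => //= l IHl r IHr i; by rewrite map_cat -IHl -IHr addSn.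
Qed.

Lemma forest_word_shift c i ts :
  forest_word (i + c) ts = [seq (a + c)%N | a <- forest_word i ts].
Proof.
elim: ts i => //= t ts IH i; by rewrite map_cat -IH -tree_word_shift addSn.
Qed.

Lemma pos_shift i l : all (fun a => i < a) l ->
  pos l * x i = x i * pos [seq a.+1 | a <- l].
Proof.
elim: l => [|a l IH] /=; first by rewrite /pos !big_nil mulg1 mul1g.
case/andP=> ia /IH e; rewrite !pos_cons -mulgA e !mulgA; congr (_ * _).
exact: x_shift.
Qed.

(** Taking apart a tree moves everything on its right by the number of its
    carets. *)
Lemma x_tree_word i j t : i < j ->
  x j * pos (tree_word i t) = pos (tree_word i t) * x (j + carets t).
Proof.
elim: t i j => [|l IHl r IHr] i j ij /=.
  by rewrite /pos big_nil mulg1 mul1g addn0.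
rewrite pos_cons pos_cat !mulgA x_shift // -!mulgA; congr (_ * _).
rewrite mulgA IHr // -!mulgA; congr (_ * _).
by rewrite IHl; [congr (_ * x _); lia | lia].
Qed.

Lemma x_forest_word i j ts : i + size ts <= j ->
  x j * pos (forest_word i ts) = pos (forest_word i ts) * x (j + fcarets ts).
Proof.
elim: ts i j => [|t ts IH] i j ij /=.
  by rewrite /pos big_nil mulg1 mul1g addn0.
rewrite pos_cat mulgA IH; last by move: ij => /=; lia.
rewrite -!mulgA x_tree_word; last by move: ij => /=; lia.
by congr (_ * (_ * x _)); rewrite /fcarets /=; lia.
Qed.

Lemma pos_tree_word_comm i l t : all (fun a => i < a) l ->
  pos l * pos (tree_word i t) =
  pos (tree_word i t) * pos [seq (a + carets t)%N | a <- l].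
Proof.
elim: l => [|a l IH] /=; first by rewrite /pos !big_nil mulg1 mul1g.
case/andP=> ia /IH e; rewrite !pos_cons -mulgA e !mulgA; congr (_ * _).
exact: x_tree_word.
Qed.

Lemma forest_word_cat i ts1 ts2 :
  forest_word i (ts1 ++ ts2) =
  forest_word (i + size ts1) ts2 ++ forest_word i ts1.
Proof.
elim: ts1 i => [|t ts1 IH] i /=; first by rewrite addn0 cats0.
by rewrite IH catA addSnnS.
Qed.

Lemma forest_word_leaves i c : forest_word i (nseq c leaf) = [::].
Proof. by elim: c i => //= c IH i; rewrite IH. Qed.

Lemma fcarets_cat ts1 ts2 :
  fcarets (ts1 ++ ts2) = (fcarets ts1 + fcarets ts2)%N.
Proof. by rewrite /fcarets map_cat sumn_cat. Qed.

Lemma fcarets_nseq c t : fcarets (nseq c t) = (c * carets t)%N.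
Proof. by rewrite /fcarets map_nseq sumn_nseq mulnC. Qed.

(** The generators act on forests by joining adjacent trees; this turns the
    algebra of positive words into operations on lists of trees. *)
Lemma forest_word_node i ts1 l r ts2 :
  pos (forest_word i (ts1 ++ node l r :: ts2)) =
  x (i + size ts1) * pos (forest_word i (ts1 ++ l :: r :: ts2)).
Proof.
rewrite !(forest_word_cat i ts1) /=; set j := (i + _)%N.
rewrite !pos_cat pos_cons pos_cat !mulgA; congr (_ * _ * _ * _).
rewrite pos_shift ?forest_word_ge //; congr (_ * pos _).
by rewrite -[j.+2]addn1 forest_word_shift; apply: eq_map => a; rewrite addn1.
Qed.

(** Every positive word p divides a forest with deep enough trees: its letters
    are root carets of the successive forests. *)
Lemma forest_split b p ts :
  all (fun i => i < size ts) p -> all (fun t => size p <= depth t) ts ->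
  all (fun t => rdepth t <= b) ts ->
  exists ts', [/\ pos (forest_word 0 ts) = pos p * pos (forest_word 0 ts'),
    size ts' = (size ts + size p)%N, (fcarets ts' + size p)%N = fcarets ts
    & all (fun t => rdepth t <= b) ts'].
Proof.
elim: p ts => [|i p IH] ts /=.
  by exists ts; rewrite !addn0 /pos big_nil mul1g.
case/andP=> its pts dts bts.
have : ts = take i ts ++ nth leaf ts i :: drop i.+1 ts.
  by rewrite -drop_nth // cat_take_drop.
have : size (take i ts) = i by rewrite size_takel // ltnW.
case: (nth leaf ts i) (drop i.+1 ts) (take i ts) => [|l r] ts2 ts1 s1 ets.
  by move: dts; rewrite ets all_cat /= andbF.
move: dts bts pts; rewrite ets !all_cat /= => /and3P[d1 d d2] /and3P[b1 b0 b2].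
rewrite size_cat /= => pts.
have [] := IH (ts1 ++ l :: r :: ts2).
- by apply: sub_all pts => a; rewrite size_cat /=; lia.
- rewrite all_cat /=; apply/and4P; split; try lia.
  + by apply: sub_all d1 => t; lia.
  + by apply: sub_all d2 => t; lia.
- by rewrite all_cat /= b1 b2; lia.
move=> ts' [e1 e2 e3 e4]; exists ts'; split=> //.
- by rewrite forest_word_node s1 add0n pos_cons -mulgA -e1.
- by rewrite e2 !size_cat /=; lia.
- by move: e3; rewrite !fcarets_cat /fcarets /=; lia.
Qed.

(** Each join puts a subtree one right turn lower, whence the growth of the
    bound on [rdepth]. *)
Lemma forest_merge b q ts :
  all (fun i => i + size q < size ts) q ->
  all (fun t => rdepth t <= b) ts ->
  exists ts', [/\ pos q * pos (forest_word 0 ts) = pos (forest_word 0 ts'),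
    (size ts' + size q)%N = size ts, fcarets ts' = (fcarets ts + size q)%N
    & all (fun t => rdepth t <= b + size q) ts'].
Proof.
elim: q => [|i q IH] /=.
  by move=> _ bts; exists ts; rewrite !addn0 /pos big_nil mul1g.
case/andP=> its qts /IH[]; first by apply: sub_all qts => a; lia.
move=> ts' [e1 e2 e3 e4].
have : ts' = take i ts' ++ nth leaf ts' i :: nth leaf ts' i.+1 :: drop i.+2 ts'.
  by rewrite -!drop_nth ?cat_take_drop //; lia.
have : size (take i ts') = i by rewrite size_takel //; lia.
move: (nth leaf ts' i) (nth leaf ts' i.+1) (drop _ _) (take _ _).
move=> l r ts2 ts1 s1 et.
exists (ts1 ++ node l r :: ts2); split.
- by rewrite forest_word_node s1 add0n pos_cons -mulgA e1 -et.
- by move: e2; rewrite et !size_cat /=; lia.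
- by rewrite addnS -e3 et !fcarets_cat /fcarets /=; lia.
- move: e4; rewrite et !all_cat /= => /and4P[a1 a2 a3 a4]; apply/and3P.
  by split; [apply: sub_all a1 => t; lia | lia | apply: sub_all a4 => t; lia].
Qed.

Lemma rdepth_lump b t ts : rdepth t <= b.+1 ->
  all (fun t => rdepth t <= b) ts -> rdepth (foldl node t ts) <= b.+1.
Proof.
elim: ts t => //= u ts IH t tb /andP[ub tsb]; apply: IH => //=; lia.
Qed.

Lemma carets_lump t ts :
  carets (foldl node t ts) = (fcarets (t :: ts) + size ts)%N.
Proof.
elim: ts t => [|u ts IH] t; first by rewrite /fcarets /= !addn0.
by rewrite /= IH /fcarets /=; lia.
Qed.

Lemma forest_word_lump t ts :
  pos (nseq (size ts) 0%N) * pos (forest_word 0 (t :: ts)) =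
  pos (tree_word 0 (foldl node t ts)).
Proof.
elim: ts t => [|u ts IH] t; first by rewrite /pos big_nil mul1g.
rewrite -[RHS]IH (forest_word_node 0 [::]) mulgA; congr (_ * _).
rewrite -pos_rcons; congr pos.
by rewrite -cats1 -[[:: _]]/(nseq 1 _) -nseqD addn1.
Qed.

(** Joining the first trees of a forest as a left comb produces a single tree
    when U is large, since the forest may be prolonged by trivial trees.  The
    comb adds at most one right turn, so that all indices stay small, whatever
    the number of trees. *)
Lemma forest_lump b U ts : 0 < size ts -> size ts <= U.+1 ->
  all (fun t => rdepth t <= b) ts ->
  exists2 l, all (fun i => i < b.+1) l &
    pos l = pos (nseq U 0%N) * pos (forest_word 0 ts) /\
    size l = (U + fcarets ts)%N.
Proof.
case: ts => //= t ts _ sU /andP[tb tsb].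
set ts' := ts ++ nseq (U - size ts) leaf.
have sz : size ts' = U by rewrite size_cat size_nseq; lia.
exists (tree_word 0 (foldl node t ts')).
  apply: sub_all (tree_word_lt _ _) => a; move/leq_trans; rewrite add0n; apply.
  apply: rdepth_lump; first exact: leqW.
  by rewrite all_cat tsb all_nseq orbT.
rewrite size_tree_word carets_lump -forest_word_lump sz; split.
  by rewrite -cat_cons forest_word_cat forest_word_leaves.
by rewrite addnC /ts' -cat_cons fcarets_cat fcarets_nseq muln0 addn0.
Qed.

(** The reason why far away carets cost nothing beyond the penalty.  In
    psi s^-1 a letter x_j^-1 with j > n may move to the left past any letter
    x_a with a < n, its index dropping by one.  As s is nondecreasing, s^-1
    starts with its largest index, so the letters that have to move do not
    obstruct each other, and psi is long enough to bring all of them down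
    to n. *)
Lemma within_slide n psi s : all (fun i => i < n) psi -> pairwise leq s ->
  all (fun i => i <= size psi + n) s ->
  within n (pos psi * (pos s)^-1) (size psi + size s).
Proof.
elim/last_ind: psi s => [|psi a IH] s.
  by move=> _ _ sn; rewrite /pos big_nil mul1g; exact/withinV/within_pos.
rewrite all_rcons size_rcons => /andP[an psin] ss sb.
(* The letters of s above n pass the last letter a of psi, the others stay
   behind it. *)
have es : s = [seq i <- s | i <= n] ++ [seq i <- s | n < i].
  elim: s ss {sb} => //= i s IHs /andP[si /IHs {1}->].
  case: (leqP i n) => //= ni; suff -> : [seq i <- s | i <= n] = [::] by [].
  apply/eqP; rewrite -[_ == _]negbK -has_filter; apply/hasPn => j js.
  by rewrite -ltnNge (leq_trans ni) //; exact: (allP si).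
move: (filter_all (fun i => i <= n) s) (filter_all (fun i => n < i) s) es.
move: [seq i <- s | i <= n] [seq i <- s | n < i] => s1 s2 a1 a2 es.
have [s3 e3 a3] : exists2 s3,
    s2 = [seq i.+1 | i <- s3] & all (fun i => n <= i) s3.
  exists [seq i.-1 | i <- s2].
    elim: s2 a2 {es} => //= i s2 IHs /andP[ni /IHs {1}->]; congr (_ :: _); lia.
  by rewrite all_map; apply: sub_all a2 => i /=; lia.
rewrite es pos_cat invgM pos_rcons.
have -> : pos psi * x a * ((pos s2)^-1 * (pos s1)^-1) =
          pos psi * (pos s3)^-1 * (x a * (pos s1)^-1).
  rewrite -!mulgA; congr (_ * _); rewrite !mulgA; congr (_ * _).
  apply: (mulgI (pos s3)); apply: (mulIg (pos s2)).
  rewrite mulVKg mulgA mulgVK e3 pos_shift //.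
  by apply: sub_all a3 => i; lia.
apply: (@within_leq _ _ ((size psi + size s3) + (1 + size s1))).
  by rewrite e3 size_cat size_map; lia.
move: ss sb; rewrite es pairwise_cat e3 pairwise_map all_cat all_map.
case/and3P=> _ _ s3s /andP[_ s3b].
apply: withinM; first by apply: IH => //; apply: sub_all s3b => i /=; lia.
apply: withinM; last exact/withinV/within_pos.
rewrite -[x a]/(letter (a, true)) -[letter _]mulg1.
exists [:: (a, true)]; rewrite /= andbT /eval big_cons big_nil; split=> //; lia.
Qed.

(** Listing the carets of a tree from the root, left subtree first, gives the
    normal form, with nondecreasing indices; this is the form required by
    [within_slide]. *)
Lemma tree_word_sorted i t : exists s, [/\ pos s = pos (tree_word i t),
  size s = carets t, pairwise leq s & all (fun a => i <= a < i + carets t) s].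
Proof.
elim: t i => [|l IHl r IHr] i; first by exists [::].
have [s1 [p1 z1 o1 a1]] := IHl i.
have [s2 [p2 z2 o2 a2]] := IHr (i.+1 + carets l)%N.
exists (i :: s1 ++ s2) => /=; rewrite size_cat z1 z2; split=> //.
- rewrite !pos_cons !pos_cat p1 p2; congr (_ * _).
  by rewrite [RHS]pos_tree_word_comm ?tree_word_ge // tree_word_shift.
- rewrite pairwise_cat o1 o2 /= andbT all_cat; apply/andP; split.
    by apply/andP; split; [apply: sub_all a1 | apply: sub_all a2] => a; lia.
  by apply/allrelP => a b /(allP a1) /= ? /(allP a2) /= ?; lia.
- rewrite all_cat; apply/and3P; split; first lia.
    by apply: sub_all a1 => a; lia.
  by apply: sub_all a2 => a; lia.
Qed.

Lemma forest_word_sorted i ts : exists s, [/\ pos s = pos (forest_word i ts),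
  size s = fcarets ts, pairwise leq s
  & all (fun a => i <= a < i + fcarets ts + size ts) s].
Proof.
elim: ts i => [|t ts IH] i; first by exists [::].
have [s1 [p1 z1 o1 a1]] := tree_word_sorted i t.
have [s2 [p2 z2 o2 a2]] := IH (i.+1 + carets t)%N.
exists (s1 ++ s2) => /=; rewrite size_cat z1 z2; split=> //.
- rewrite !pos_cat p1 p2.
  by rewrite [RHS]pos_tree_word_comm ?forest_word_ge // forest_word_shift.
- rewrite pairwise_cat o1 o2 /= andbT.
  by apply/allrelP => a b /(allP a1) /= ? /(allP a2) /= ?; lia.
- rewrite all_cat /fcarets /= in a2 *; apply/andP; split.
    by apply: sub_all a1 => a; lia.
  by apply: sub_all a2 => a; lia.
Qed.

(** The inverse of a generator passes through a positive word, or cancels one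
    of its letters; r has at most one letter. *)
Lemma xV_pos i b p : all (fun a => a <= b) p ->
  exists p' r, [/\ (x i)^-1 * pos p = pos p' * (pos r)^-1,
    size p' + size r <= (size p).+1, all (fun a => a <= b.+1) p'
    & all (fun a => a <= i + size p) r].
Proof.
elim: p i => [|j p IH] i /=.
  exists [::], [:: i]; rewrite /= addn0 leqnn.
  by rewrite /pos big_nil big_seq1 mulg1 mul1g.
case/andP=> jb pb; rewrite pos_cons mulgA; case: (ltngtP i j) => [ij|ji|->].
- have [p' [r [e1 e2 e3 e4]]] := IH i pb; exists (j.+1 :: p'), r.
  have -> : (x i)^-1 * x j = x j.+1 * (x i)^-1.
    by rewrite -(thompson_xJ ij) mulgK.
  rewrite -mulgA e1 pos_cons mulgA /= ltnS jb; split=> //.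
  by apply: sub_all e4 => a; lia.
- have [p' [r [e1 e2 e3 e4]]] := IH i.+1 pb; exists (j :: p'), r.
  have -> : (x i)^-1 * x j = x j * (x i.+1)^-1.
    by rewrite xV_shift.
  rewrite -mulgA e1 pos_cons mulgA /= (leqW jb); split=> //.
  by apply: sub_all e4 => a; lia.
- exists p, [::]; rewrite mulVg mul1g /pos big_nil invg1 mulg1 /=; split=> //.
    lia.
  by apply: sub_all pb => a; lia.
Qed.

(** F is a group of right fractions of its positive monoid, without
     increase of length. *)
Lemma eval_fraction n v : all (fun a => a.1 <= n) v ->
  exists p q, [/\ eval v = pos p * (pos q)^-1, size p + size q <= size v,
    all (fun a => a <= n + size v) p & all (fun a => a <= n + size v) q].
Proof.
elim: v => [|[i b] v IH] /=.
  by exists [::], [::]; rewrite /eval /pos !big_nil invg1 mulg1.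
case/andP=> ib /IH[p [q [e1 e2 e3 e4]]]; rewrite /eval big_cons -/(eval v) e1.
case: b => /=; rewrite /letter /=.
  exists (i :: p), q; rewrite pos_cons mulgA /=; split=> //.
    by apply/andP; split; [lia | apply: sub_all e3 => a; lia].
  by apply: sub_all e4 => a; lia.
have [p' [r [f1 f2 f3 f4]]] := xV_pos i e3.
exists p', (q ++ r); rewrite pos_cat invgM mulgA f1 !mulgA size_cat; split=> //.
- lia.
- by apply: sub_all f3 => a; lia.
- rewrite all_cat; apply/andP.
  by split; [apply: sub_all e4 | apply: sub_all f4] => a; lia.
Qed.

(** * The upper bound *)

(** The letter x_(n + K) comes first, which is where it is conjugated by powers
    of x_0 in the first case of [pocket_upper]; between forests with the
    same number of carets, it could also stand at the end. *)
Definition pocket n K r P N : thompsonF :=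
  (x (n + K))^-1 * pos (forest_word 0 (nseq r P)) *
  (pos (forest_word 0 (nseq r N)))^-1.

Lemma x_conj_x0 n c : 0 < n ->
  x (n + c) = (pos (nseq c 0%N))^-1 * x n * pos (nseq c 0%N).
Proof.
move=> n0; apply: (mulgI (pos (nseq c 0%N))); rewrite -!mulgA mulVKg.
elim: c n n0 => [|c IH] n n0; first by rewrite /pos big_nil mulg1 mul1g addn0.
by rewrite /= pos_cons mulgA x_shift // -!mulgA -IH // addSnnS.
Qed.

Lemma within_x n i : i <= n -> within n (x i) 1.
Proof.
move=> le_in; exists [:: (i, true)].
by rewrite /= le_in /eval big_seq1.
Qed.

(** The combination of [forest_lump] and [within_slide]: a route through a
    single tree. *)
Lemma within_lump n b U ts ts' : 0 < size ts -> size ts <= U.+1 -> b < n ->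
  all (fun t => rdepth t <= b) ts ->
  fcarets ts' + size ts' <= U + fcarets ts + n ->
  within n
    (pos (nseq U 0%N) * pos (forest_word 0 ts) * (pos (forest_word 0 ts'))^-1)
    (U + fcarets ts + fcarets ts').
Proof.
move=> ts0 tsU bn tsb c; have [l lb [<- zl]] := forest_lump ts0 tsU tsb.
have [s [<- zs os bs]] := forest_word_sorted 0 ts'; rewrite -zl -zs.
apply: within_slide => //; first by apply: sub_all lb => i; lia.
by rewrite zl; apply: sub_all bs => i; lia.
Qed.

(** The bound is the length of the pocket itself.  All constants are absorbed
    by the penalty K, which leaves ample room in [within_slide]; only the
    hypothesis on [rdepth N] ties k to n. *)
Lemma pocket_upper n k K r P N v : 0 < n -> carets P = carets N ->
  rdepth P < n -> rdepth N + k < n -> k <= depth N -> n + 2 * k < r <= K ->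
  all (fun a => a.1 <= n) v -> size v <= k ->
  within n (pocket n K r P N * eval v) (2 * K + 1 + 2 * (r * carets P)).
Proof.
move=> n0 cPN dP dN kN /andP[nr rK] vn vk.
have [p [q [-> zpq pb qb]]] := eval_fraction vn.
have [|||ts1 [e1 z1 c1 b1]] := @forest_split (rdepth N) p (nseq r N).
- by rewrite size_nseq; apply: sub_all pb => i; lia.
- by rewrite all_nseq; lia.
- by rewrite all_nseq leqnn orbT.
move: z1 c1; rewrite size_nseq fcarets_nseq => z1 c1.
have [||ts2 [e2 z2 c2 b2]] := @forest_merge (rdepth N) q ts1.
- by rewrite z1; apply: sub_all qb => i; lia.
- exact: b1.
have b2k : all (fun t => rdepth t <= rdepth N + k) ts2.
  by apply: sub_all b2 => t; lia.
set A := nseq r P.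
have cA : fcarets A = (r * carets P)%N by rewrite fcarets_nseq.
have zA : size A = r by rewrite size_nseq.
have -> : pocket n K r P N * (pos p * (pos q)^-1) =
    (x (n + K))^-1 * (pos (forest_word 0 A) * (pos (forest_word 0 ts2))^-1).
  by rewrite /pocket e1 -e2 !invgM -!mulgA mulKg.
(* At least as many splits as joins: keep the penalty carets, which join the
   trees of A. *)
have [pq|qp] := leqP (size q) (size p).
  have -> :
      (x (n + K))^-1 * (pos (forest_word 0 A) * (pos (forest_word 0 ts2))^-1) =
      (pos (nseq K 0%N))^-1 * (x n)^-1 *
      (pos (nseq K 0%N) * pos (forest_word 0 A) * (pos (forest_word 0 ts2))^-1).
    by rewrite x_conj_x0 // !invgM invgK -!mulgA.
  apply: (@within_leq _ _ (K + 1 + (K + fcarets A + fcarets ts2))).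
    by rewrite cA; lia.
  apply: withinM; last first.
    apply: (within_lump (b := rdepth P)); rewrite ?zA ?cA //; try lia.
    by rewrite all_nseq leqnn orbT.
  apply: withinM; last exact/withinV/within_x.
  have := @within_pos n (nseq K 0%N); rewrite all_nseq orbT size_nseq => h.
  exact/withinV/h.
(* More joins than splits: ts2 has fewer trees than A, and with x_(n + K) moved
   to the end of the word only U < K penalty carets are needed. *)
have eU : (n + (K + size p - size q) + fcarets ts2 = n + K + fcarets A)%N.
  by rewrite cA; lia.
set U := (K + size p - size q)%N in eU.
have -> :
  (x (n + K))^-1 * (pos (forest_word 0 A) * (pos (forest_word 0 ts2))^-1) =
  (pos (nseq U 0%N) * pos (forest_word 0 ts2) * (pos (forest_word 0 A))^-1)^-1 *
  ((x n)^-1 * pos (nseq U 0%N)).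
  have xA : (x (n + K))^-1 * pos (forest_word 0 A) =
            pos (forest_word 0 A) * (x (n + K + fcarets A))^-1.
    apply: (mulgI (x (n + K))); apply: (mulIg (x (n + K + fcarets A))).
    by rewrite mulVKg -!mulgA mulVg mulg1 x_forest_word // zA; lia.
  rewrite mulgA xA -eU -!mulgA !invgM invgK -!mulgA; congr (_ * _).
  rewrite -invgM -x_forest_word; last by lia.
  by rewrite x_conj_x0 // !invgM invgK ?mulgA.
apply: (@within_leq _ _ ((U + fcarets ts2 + fcarets A) + (1 + U))).
  by rewrite cA /U; lia.
apply: withinM.
  apply: withinV; apply: (within_lump (b := rdepth N + k)) => //.
  - lia.
  - by rewrite /U; lia.
  - by rewrite cA zA /U; lia.
apply: withinM; first exact/withinV/within_x.
by have := @within_pos n (nseq U 0%N); rewrite all_nseq orbT size_nseq; apply.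
Qed.

(** * The action on gaps *)

(** A gap of a forest: (a, None) is the open gap between the trees a - 1 and a,
    and (a, Some u) is the gap of the caret at the node u of tree a, where false
    and true are left and right turns.  A dyadic rational a + 0.u1 would be
    another name for the latter; F acts here as on the dyadic rationals. *)
Definition cut := (nat * option (seq bool))%type.

Definition split_at i (c : cut) : cut :=
  let: (a, s) := c in
  if a < i then (a, s) else if i < a then (a.+1, s) else
  match s with
  | None => (i, None)
  | Some [::] => (i.+1, None)
  | Some (false :: u) => (i, Some u)
  | Some (true :: u) => (i.+1, Some u)
  end.

Definition merge_at i (c : cut) : cut :=
  let: (a, s) := c in
  if a < i then (a, s) else if i.+1 < a then (a.-1, s) else
  match s with
  | None => if a == i then (i, None) else (i, Some [::])
  | Some u => (i, Some ((a != i) :: u))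
  end.

Definition act (a : nat * bool) := if a.2 then split_at a.1 else merge_at a.1.

Definition acts (v : word nat) (c : cut) := foldl (fun c a => act a c) c v.

Lemma split_atK i : cancel (split_at i) (merge_at i).
Proof.
case=> a s; rewrite /split_at; case: (ltngtP a i) => [ai|ia|->].
- by rewrite /merge_at ai.
- by rewrite /merge_at; case: ltnP => [|_]; [lia|rewrite ltnS ia].
- case: s => [[|[] u]|]; rewrite /merge_at.
  + by rewrite !ltnn ltnNge leqnSn /=; case: eqP => //; lia.
  + by rewrite !ltnn ltnNge leqnSn /=; case: eqP => //; lia.
  + by rewrite ltnn ltnNge leqnSn /= eqxx.
  + by rewrite ltnn ltnNge leqnSn /= eqxx.
Qed.

Lemma merge_atK i : cancel (merge_at i) (split_at i).
Proof.
case=> a s; rewrite /merge_at; case: (ltnP a i) => [ai|ia].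
  by rewrite /split_at ai.
case: ltnP => [ia1|ai1].
  rewrite /split_at; case: ltnP => [|_]; first lia.
  by case: ltnP => [_|]; [congr (_, _); lia | lia].
rewrite /split_at; case: s => [u|]; last first.
  case: eqP => [->|ne]; first by rewrite ltnn.
  by rewrite ltnn; congr (_, _); lia.
by rewrite ltnn; case: eqP => [->//|ne] /=; congr (_, _); lia.
Qed.

Lemma actK i b : cancel (act (i, b)) (act (i, ~~ b)).
Proof. by case: b; [exact: split_atK | exact: merge_atK]. Qed.

Lemma act_inj a : injective (act a).
Proof. by case: a => i b; apply: can_inj (actK i b). Qed.

Lemma acts_inj v : injective (acts v).
Proof. by elim: v => [|a v IH] c d //= /IH /act_inj. Qed.

Lemma acts_cat u v c : acts (u ++ v) c = acts v (acts u c).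
Proof. exact: foldl_cat. Qed.

Lemma split_lt i a s : a < i -> split_at i (a, s) = (a, s).
Proof. by rewrite /split_at => ->. Qed.

Lemma split_gt i a s : i < a -> split_at i (a, s) = (a.+1, s).
Proof. by move=> ia; rewrite /split_at ia ltnNge ltnW. Qed.

Lemma split_eq i s : split_at i (i, s) =
  match s with
  | None => (i, None)
  | Some [::] => (i.+1, None)
  | Some (false :: u) => (i, Some u)
  | Some (true :: u) => (i.+1, Some u)
  end.
Proof. by rewrite /split_at ltnn. Qed.

Lemma split_shift i j c : i < j ->
  split_at i (split_at j c) = split_at j.+1 (split_at i c).
Proof.
case: c => a s ij; case: (ltngtP a i) => [ai|ia|->].
- by rewrite !split_lt //; lia.
- case: (ltngtP a j) => [aj|ja|->].
  + by rewrite split_lt // split_gt // split_lt.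
  + by rewrite (split_gt s ja) !split_gt //; lia.
  + rewrite (split_gt s ij) !split_eq.
    by case: s => [[|[] u]|]; rewrite split_gt // ltnW.
- rewrite (split_lt s ij) split_eq.
  by case: s => [[|[] u]|]; rewrite split_lt // ltnW.
Qed.

Lemma acts_eqv u v : word_eqv thompson_rel u v -> acts u =1 acts v.
Proof.
elim=> {u v} [u|u v _ IH|u v w _ IH1 _ IH2|u u' v v' _ IH1 _ IH2|i b|u v].
- by [].
- by move=> c; rewrite IH.
- by move=> c; rewrite IH1.
- by move=> c; rewrite !acts_cat IH1 IH2.
- by move=> c; exact: actK.
- by case=> i j ij c; rewrite /acts /= /act /= split_shift // merge_atK.
Qed.

Lemma acts_eval u v : eval u = eval v -> acts u =1 acts v.
Proof. by rewrite -!class_eval => /classP; exact: acts_eqv. Qed.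

Definition closed (c : cut) : bool := c.2.

(** The only gap that the letter opens or closes: the root caret of tree i, or
    the gap between the trees i and i+1. *)
Definition toggled_cut (a : nat * bool) : cut :=
  if a.2 then (a.1, Some [::]) else (a.1.+1, None).

Lemma act_toggled_cut a c : closed (act a c) != closed c -> c = toggled_cut a.
Proof.
case: a c => i [] [a s]; rewrite /closed /act /toggled_cut /=.
  case: (ltngtP a i) => [ai|ia|->] /=; rewrite ?eqxx //.
  by case: s => [[|[] u]|].
case: ltnP => [ai|ia]; first by rewrite eqxx.
case: ltnP => [ia1|ai1]; first by rewrite eqxx.
case: s => [u|] //=; case: (a =P i) => //= ne _; congr (_, _); lia.
Qed.

Fixpoint toggles (v : word nat) (c : cut) : nat :=
  if v is a :: v' then (closed (act a c) != closed c) + toggles v' (act a c)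
  else 0.

Lemma toggles_cat u v c :
  toggles (u ++ v) c = toggles u c + toggles v (acts u c).
Proof. by elim: u c => //= a u IH c; rewrite IH addnA. Qed.

Lemma odd_toggles v c : odd (toggles v c) = closed c (+) closed (acts v c).
Proof.
elim: v c => [|a v IH] c /=; first by rewrite addbb.
rewrite oddD IH -/(acts v _).
by case: (closed (acts v _)) (closed (act a c)) (closed c) => [] [] [].
Qed.

(** A letter acts injectively, so at most one gap of s is the one it toggles. *)
Lemma sum_toggles v s : uniq s -> \sum_(c <- s) toggles v c <= size v.
Proof.
elim: v s => [|a v IH] s us /=; first by rewrite big1_eq.
rewrite big_split /= -[(size v).+1]add1n leq_add //; last first.
  rewrite -(big_map (act a) xpredT (toggles v)); apply: IH.
  by rewrite map_inj_uniq //; exact: act_inj.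
apply: (@leq_trans (\sum_(c <- s) (c == toggled_cut a))).
  apply: leq_sum => c _; case: eqVneq => //= ?.
  by rewrite [_ == toggled_cut a](introT eqP) //; apply: act_toggled_cut.
have -> : \sum_(c <- s) (c == toggled_cut a) = count_mem (toggled_cut a) s.
  by elim: s {us} => [|c s IHs]; rewrite ?big_nil // big_cons IHs.
by rewrite count_uniq_mem // leq_b1.
Qed.

(** The caret of d is a proper descendant of the caret of c.  Only the opening
    of c can destroy this relation. *)
Definition under (d c : cut) := exists a u w,
  [/\ w != [::], c = (a, Some u) & d = (a, Some (u ++ w))].

Lemma under_asym c d : under d c -> ~ under c d.
Proof.
case=> a [u [w [w0 -> ->]]] [b [u' [w' [w0' [_ <-] [_ /eqP]]]]].
rewrite -catA -{1}[u]cats0 eqseq_cat // eqxx /= => /eqP.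
by case: w w0 => //; case: w'.
Qed.

Lemma under_act a c d : closed (act a c) -> under d c ->
  under (act a d) (act a c).
Proof.
move=> cl [b [u [w [w0 ec ed]]]]; move: cl; rewrite {}ec {}ed.
case: a => i []; rewrite /act /=.
  case: (ltngtP b i) => [_ _|_ _|_].
  - by exists b, u, w.
  - by exists b.+1, u, w.
  - by case: u => [|[] u] //= _; [exists i.+1, u, w | exists i, u, w].
case: ltnP => _; first by exists b, u, w.
case: ltnP => _; first by exists b.-1, u, w.
by exists i, ((b != i) :: u), w.
Qed.

Lemma toggles0_under v c d : toggles v c = 0 -> closed c ->
  under d c <-> under (acts v d) (acts v c).
Proof.
elim: v c d => [|a v IH] c d //= /eqP; rewrite addn_eq0 => /andP[].
rewrite eqb0 negbK => /eqP ea /eqP t0 cc.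
have ca : closed (act a c) by rewrite ea.
rewrite -(IH _ (act a d)) //; split; first exact: under_act.
move=> h; case: a {IH t0} ea ca h => i b ea ca h.
rewrite -(actK i b c) -(actK i b d); apply: under_act => //.
by rewrite actK.
Qed.

(** Two carets that exchange their rank: had one of them never been opened, it
    would still have, or would have had before, the other one below it.  Since
    both gaps are closed at both ends, they toggle an even number of times. *)
Lemma toggles_ge2 v c d : under d c -> under (acts v c) (acts v d) ->
  2 <= toggles v c /\ 2 <= toggles v d.
Proof.
move=> h h'; have [cc cd] : closed c /\ closed d.
  by case: h => a [u [w [_ -> ->]]].
have [cc' cd'] : closed (acts v c) /\ closed (acts v d).
  by case: h' => a [u [w [_ -> ->]]].
have oc := odd_toggles v c; have od := odd_toggles v d.
rewrite cc cc' in oc; rewrite cd cd' in od; split.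
  case tc : (toggles v c) oc => [|[|t]] // _.
  by case: (under_asym h'); apply/(toggles0_under d tc cc).
case td : (toggles v d) od => [|[|t]] // _.
by case: (under_asym h); apply/(toggles0_under c td cd).
Qed.

(** The node of the e-th caret from the left, for 1 <= e <= carets t; its gap
    lies between the leaves e - 1 and e. *)
Fixpoint caret_addr t e :=
  if t is node l r then
    if e <= carets l then false :: caret_addr l e
    else if e == (carets l).+1 then [::]
    else true :: caret_addr r (e - (carets l).+1)
  else [::].

Definition splits l := acts [seq (i, true) | i <- l].

Lemma splits_cons i l c : splits (i :: l) c = splits l (split_at i c).
Proof. by []. Qed.

Lemma splits_cat l1 l2 c : splits (l1 ++ l2) c = splits l2 (splits l1 c).
Proof. by rewrite /splits map_cat acts_cat. Qed.

Lemma splits_lt i l a s : all (fun j => i <= j) l -> a < i ->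
  splits l (a, s) = (a, s).
Proof.
elim: l => //= j l IH /andP[ij il] ai.
by rewrite splits_cons split_lt ?IH // (leq_trans ai).
Qed.

Lemma splits_root i l : all (fun j => i <= j) l ->
  splits l (i, None) = (i, None).
Proof.
elim: l => //= j l IH /andP[ij il].
rewrite splits_cons; case: ltngtP ij => // [ij _|<- _].
  by rewrite split_lt ?IH.
by rewrite split_eq IH.
Qed.

Lemma splits_tree_word_gt i t a s : i < a ->
  splits (tree_word i t) (a, s) = (a + carets t, s)%N.
Proof.
elim: t i a => [|l IHl r IHr] i a ia /=; first by rewrite addn0.
rewrite splits_cons split_gt // splits_cat.
by rewrite IHr // IHl; [congr (_, _); lia | lia].
Qed.

Lemma splits_tree_word i t e : 0 < e <= carets t ->
  splits (tree_word i t) (i, Some (caret_addr t e)) = (i + e, None)%N.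
Proof.
elim: t i e => [|l IHl r IHr] i e /= /andP[e0 et]; first by lia.
rewrite splits_cons splits_cat split_eq.
case: leqP => [el|le].
  by rewrite (splits_lt _ (tree_word_ge _ _)) // IHl // e0.
case: eqP => [->|ne].
  rewrite (splits_root (tree_word_ge _ _)) splits_tree_word_gt //.
  by congr (_, _); lia.
rewrite IHr; last by lia.
by rewrite splits_tree_word_gt; [congr (_, _); lia | lia].
Qed.

Lemma splits_forest_word_gt i ts a s : i + size ts <= a ->
  splits (forest_word i ts) (a, s) = (a + fcarets ts, s)%N.
Proof.
elim: ts i => [|t ts IH] i /= ia; first by rewrite addn0.
rewrite splits_cat IH ?splits_tree_word_gt; try lia.
by congr (_, _); rewrite /fcarets /=; lia.
Qed.

(** After c copies of t have been taken apart, the position of a gap counts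
    the leaves on its left.  Hence forests of trees of equal size identify
    their gaps by number. *)
Lemma splits_forest_word_open i c t a : a <= c ->
  splits (forest_word i (nseq c t)) (i + a, None)%N =
  (i + a * (carets t).+1, None)%N.
Proof.
elim: c i a => [|c IH] i [|a] // ac; rewrite ?mul0n ?addn0.
  by rewrite splits_root ?forest_word_ge.
rewrite /= splits_cat -addSnnS IH // splits_tree_word_gt; last by lia.
by congr (_, _); lia.
Qed.

Lemma splits_forest_word_closed i c t a e : a < c -> 0 < e <= carets t ->
  splits (forest_word i (nseq c t)) (i + a, Some (caret_addr t e))%N =
  (i + a * (carets t).+1 + e, None)%N.
Proof.
elim: c i a => [|c IH] i [|a] // ac et; rewrite ?mul0n ?addn0 /= splits_cat.
  by rewrite (splits_lt _ (forest_word_ge _ _)) // splits_tree_word.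
rewrite -addSnnS IH // splits_tree_word_gt; last by lia.
by congr (_, _); lia.
Qed.

(** The infix order on the nodes, then the order from left to right on the
    gaps; as F preserves it, the position of an open gap bounds the number of
    open gaps on its left. *)
Fixpoint addr_lt (s t : seq bool) :=
  match s, t with
  | [::], true :: _ => true
  | false :: _, [::] => true
  | b :: s', c :: t' => if b == c then addr_lt s' t' else ~~ b
  | _, _ => false
  end.

Definition cut_lt (c d : cut) :=
  (c.1 < d.1) || ((c.1 == d.1) &&
    match c.2, d.2 with
    | None, Some _ => true
    | Some s, Some t => addr_lt s t
    | _, _ => false
    end).

Local Arguments split_at : simpl never.

Lemma cut_lt_split i c d : cut_lt c d -> cut_lt (split_at i c) (split_at i d).
Proof.
have ge b t : b <= (split_at i (b, t)).1.
  by rewrite /split_at; case: ltngtP => // ->; case: t => [[|[] u]|] /=.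
have le b t : (split_at i (b, t)).1 <= b.+1.
  by rewrite /split_at; case: ltngtP => //= ->; case: t => [[|[] u]|] /=.
case: c d => a s [b t]; case/orP => /= [ab|/andP[/eqP <-]].
  apply/orP; left; case: (ltngtP a i) => [ai|ia|ai].
  - by rewrite split_lt // (leq_trans ab).
  - by rewrite !split_gt // (ltn_trans ia).
  - by rewrite [split_at i (b, t)]split_gt ?(leq_ltn_trans (le _ _)) // -ai.
case: (ltngtP a i) => [ai|ia|->].
- by rewrite !split_lt // /cut_lt ltnn eqxx.
- by rewrite !split_gt // /cut_lt ltnn eqxx.
rewrite !split_eq; case: s t => [[|[] u]|] [[|[] w]|] //= h.
all: by rewrite /cut_lt /= ?ltnSn // ltnn eqxx.
Qed.

Lemma cut_lt_merge i c d : cut_lt c d -> cut_lt (merge_at i c) (merge_at i d).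
Proof.
case: c d => a s [b t]; rewrite {1}/cut_lt /= => h.
case: (ltnP a i) => [ai|ia].
  case: (ltnP b i) => [bi|ib]; first exact: h.
  have {h} ab : a < b by case/orP: h => [|/andP[/eqP ab _]]; lia.
  by case: ltnP => ?; [|case: t => [t|]; case: eqP => ?];
    rewrite /cut_lt /=; apply/orP; left; lia.
case: (ltnP b i) => [bi|ib]; first by lia.
case: (ltnP i.+1 b) => [bi|ib1].
  case: (ltnP i.+1 a) => [ai|ai].
    rewrite /cut_lt /=; case/orP: h => [ab|/andP[/eqP -> ->]]; last first.
      by rewrite eqxx orbT.
    by apply/orP; left; lia.
  by case: s h => [s|] h; [|case: eqP => _];
    rewrite /cut_lt /=; apply/orP; left; lia.
case: ltnP => [ai1|ai1]; first by lia.
have [ea|ea] : a = i \/ a = i.+1 by lia.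
  have [eb|eb] : b = i \/ b = i.+1 by lia.
    move: h; rewrite {}ea {}eb ltnn !eqxx /=.
    by case: s t => [u|] [w|]; rewrite /cut_lt /= ?eqxx ?ltnn.
  rewrite ea eb eqxx (gtn_eqF (ltnSn i)).
  by case: s {h} => [u|]; case: t => [w|]; rewrite /cut_lt /= ?eqxx ?orbT.
have eb : b = i.+1 by case/orP: h => [|/andP[/eqP]]; lia.
move: h; rewrite ea eb ltnn eqxx (gtn_eqF (ltnSn i)) /=.
by case: s t => [u|] [w|]; rewrite /cut_lt /= ?eqxx ?ltnn.
Qed.

Lemma cut_lt_acts v c d : cut_lt c d -> cut_lt (acts v c) (acts v d).
Proof.
elim: v c d => //= -[i []] v IH c d cd; apply: IH; rewrite /act /=.
  exact: cut_lt_split.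
exact: cut_lt_merge.
Qed.

(** * The lower bound *)

Fixpoint left_comb c := if c is c'.+1 then node (left_comb c') leaf else leaf.

(** A complete tree with each leaf replaced by a right comb of two carets.  The
    left leaves of the latter make [deep_tree_left_leaf] true down to the
    bottom; a plain complete tree would share the leftmost caret with the left
    comb. *)
Fixpoint deep_tree d :=
  if d is d'.+1 then node (deep_tree d') (deep_tree d')
  else node leaf (node leaf leaf).

Lemma carets_left_comb c : carets (left_comb c) = c.
Proof. by elim: c => //= c ->; rewrite addn0. Qed.

Lemma rdepth_left_comb c : rdepth (left_comb c) <= 1.
Proof. by elim: c => //= c IH; rewrite geq_max IH. Qed.

Lemma rdepth_deep_tree d : rdepth (deep_tree d) = d.+2.
Proof. by elim: d => //= d ->; rewrite maxnE; lia. Qed.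

Lemma depth_deep_tree d : depth (deep_tree d) = d.+1.
Proof. by elim: d => //= d ->; rewrite minnn. Qed.

Lemma carets_deep_tree d : 1 < carets (deep_tree d).
Proof. by elim: d => //= d IH; lia. Qed.

Lemma caret_addr_left_comb c e : 0 < e <= c ->
  caret_addr (left_comb c) e = nseq (c - e) false.
Proof.
elim: c => [|c IH] /andP[e0 ec] /=; first by lia.
rewrite carets_left_comb; case: leqP => [le_ec|ce].
  by rewrite IH ?e0 // subSn.
have -> : e = c.+1 by lia.
by rewrite eqxx subnn.
Qed.

(** The leaf e of t is a left child, hence the caret on its right is below the
    caret on its left.  In a left comb it is the other way around for all inner
    leaves. *)
Definition left_leaf t e := 0 < e < carets t /\
  exists2 w, w != [::] & caret_addr t e.+1 = caret_addr t e ++ w.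

(** At the root gap of a node the first leaf of the right subtree will do, so
    the property passes from two subtrees to the tree. *)
Lemma deep_tree_left_leaf d e : 0 < e <= carets (deep_tree d) ->
  left_leaf (deep_tree d) e \/ (1 < e /\ left_leaf (deep_tree d) e.-1).
Proof.
elim: d e => [|d IH] e.
  case: e => [|[|[|e]]] // _; [left|right].
    by split=> //; exists [:: true].
  by split=> //; split=> //; exists [:: true].
rewrite [deep_tree d.+1]/=; move: (deep_tree d) (carets_deep_tree d) IH.
move=> t t1 IH /= /andP[e0 et].
have in_left e' : left_leaf t e' -> left_leaf (node t t) e'.
  case=> e'b [w w0 ew]; split=> /=; first by lia.
  by exists w => //; rewrite !ifT ?ew //; lia.
have in_right e' : left_leaf t e' -> left_leaf (node t t) ((carets t).+1 + e').
  case=> e'b [w w0 ew]; split=> /=; first by lia.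
  exists w => //; rewrite !ifF; try lia.
  by rewrite -addnS !addKn ew.
case: (ltngtP e (carets t).+1) => [le|lt|->].
- have [|h|[e1 h]] := IH e; first by lia.
    by left; exact: in_left.
  by right; split=> //; exact: in_left.
- have [|h|[e1 h]] := IH (e - (carets t).+1); first by lia.
    by left; rewrite -(subnKC (ltnW lt)); exact: in_right.
  right; split; first by lia.
  have -> : e.-1 = ((carets t).+1 + (e - (carets t).+1).-1)%N by lia.
  exact: in_right.
- left; split=> /=; first by lia.
  exists (true :: caret_addr t 1) => //.
  by rewrite ltnn eqxx !ifF ?subSnn //; lia.
Qed.

(** The bound holds for any word v that spells the pocket; gaps are named after
    their positions in the forest of left combs where v starts. *)
Section LowerBound.

Variables (n K r d : nat) (v : word nat).

Let t := deep_tree d.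
Let L := carets t.
Let M := (n + K)%N.

Hypotheses (rM : r <= M) (vn : all (fun a => a.1 <= n) v)
  (vw : eval v = pocket n K r (left_comb L) t).

(** The two forests of the pocket are moved to opposite sides, so that only
    splitting has to be computed. *)
Lemma pocket_acts c :
  splits (forest_word 0 (nseq r t)) (acts v c) =
  splits (forest_word 0 (nseq r (left_comb L))) (merge_at M c).
Proof.
rewrite /splits -acts_cat -[RHS]/(acts ((M, false) :: _) c); apply: acts_eval.
rewrite eval_cat vw !eval_pos /pocket mulgVK /eval big_cons big_map.
by rewrite /letter.
Qed.

Lemma pocket_acts_open a : a <= M -> acts v (a, None) = (a, None).
Proof.
move=> aM; apply: (@acts_inj [seq (i, true) | i <- forest_word 0 (nseq r t)]).
rewrite -!/(splits _ _) pocket_acts.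
have -> : merge_at M (a, None) = (a, None).
  rewrite /merge_at; case: ltnP => // Ma; rewrite ltnNge ltnW //=.
  have -> : a = M by lia.
  by rewrite eqxx.
case: (leqP a r) => [ar|ra].
  by rewrite -[a]add0n !splits_forest_word_open // carets_left_comb.
by rewrite !splits_forest_word_gt ?size_nseq ?fcarets_nseq
  ?carets_left_comb //; lia.
Qed.

Lemma pocket_acts_last : acts v (M.+1, None) = (M, Some [::]).
Proof.
apply: (@acts_inj [seq (i, true) | i <- forest_word 0 (nseq r t)]).
rewrite -!/(splits _ _) pocket_acts.
have -> : merge_at M (M.+1, None) = (M, Some [::]).
  by rewrite /merge_at ltnNge leqnSn ltnn /= gtn_eqF.
by rewrite !splits_forest_word_gt ?size_nseq ?fcarets_nseq
  ?carets_left_comb //; lia.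
Qed.

Lemma pocket_acts_closed a e : a < r -> 0 < e <= L ->
  acts v (a, Some (caret_addr (left_comb L) e)) = (a, Some (caret_addr t e)).
Proof.
move=> ar eL.
apply: (@acts_inj [seq (i, true) | i <- forest_word 0 (nseq r t)]).
rewrite -!/(splits _ _) pocket_acts.
have -> s : merge_at M (a, s) = (a, s).
  by rewrite /merge_at (leq_trans ar).
rewrite -[a]add0n !splits_forest_word_closed ?carets_left_comb //.
Qed.

Lemma pocket_toggles_closed a e : a < r -> 0 < e <= L ->
  2 <= toggles v (a, Some (caret_addr (left_comb L) e)).
Proof.
move=> ar eL.
have key f : left_leaf t f ->
    2 <= toggles v (a, Some (caret_addr (left_comb L) f.+1)) /\
    2 <= toggles v (a, Some (caret_addr (left_comb L) f)).
  case=> fL [w w0 fw]; apply: toggles_ge2.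
    exists a, (caret_addr (left_comb L) f.+1), [:: false]; split=> //.
    rewrite !caret_addr_left_comb; try by rewrite -/L in fL *; lia.
    rewrite -[[:: false]]/(nseq 1 false) -nseqD; congr (_, Some (nseq _ _)).
    by rewrite -/L in fL; lia.
  exists a, (caret_addr t f), w; split=> //; rewrite pocket_acts_closed ?fw //.
    by rewrite -/L in fL; lia.
  by rewrite -/L in fL; lia.
have [/key[]|[e1 /key[]]] := deep_tree_left_leaf eL => //.
by rewrite (ltn_predK e1).
Qed.

Lemma close_event u a : closed (acts u (a, None)) ->
  exists u1 i u2,
    u = u1 ++ (i, false) :: u2 /\ acts u1 (a, None) = (i.+1, None).
Proof.
elim/last_ind: u => [|u [i b] IH] //=; rewrite -cats1 acts_cat => cu.
case cu1: (closed (acts u (a, None))).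
  have [u1 [j [u2 [-> h]]]] := IH cu1.
  by exists u1, j, (u2 ++ [:: (i, b)]); rewrite -catA.
have e : acts u (a, None) = toggled_cut (i, b).
  by apply: act_toggled_cut; move: cu => /=; rewrite cu1 => ->.
by case: b {cu} e => e; [rewrite e in cu1 | exists u, i, [::]].
Qed.

Lemma acts_0 u : acts u (0, None) = (0, None).
Proof. by elim: u => //= -[[|i] []] u IH. Qed.

(** When the gap M+1 is closed by x_i^-1, it is at position i+1, so that at most
    i <= n of the gaps 1, ..., M are open.  The closed ones were open before
    and will be open again. *)
Lemma pocket_toggles_open : 2 * K <= \sum_(a <- iota 1 M) toggles v (a, None).
Proof.
have [|u1 [i [u2 [ev e1]]]] := @close_event v M.+1.
  by rewrite pocket_acts_last.
have le_in : i <= n by move: vn; rewrite ev all_cat /= => /and3P[].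
pose op a := ~~ closed (acts u1 (a, None)).
(* Open gaps are at distinct positions between 1 and i. *)
have cnt : count op (iota 1 M) <= n.
  rewrite -size_filter -(size_map (fun a => (acts u1 (a, None)))).
  apply: leq_trans le_in; rewrite -[i](size_iota 1).
  rewrite -[X in _ <= X](size_map (fun a => (a, None : option (seq bool)))).
  apply: uniq_leq_size.
    by rewrite map_inj_uniq ?filter_uniq ?iota_uniq // => a b /acts_inj[].
  move=> c /mapP[a]; rewrite mem_filter mem_iota => /andP[opa aM] ec.
  have h0 : cut_lt (0, None) c.
    by rewrite ec -(acts_0 u1); apply: cut_lt_acts; rewrite /cut_lt /=; lia.
  have h1 : cut_lt c (i.+1, None).
    by rewrite ec -e1; apply: cut_lt_acts; rewrite /cut_lt /=; lia.
  move: opa; rewrite /op -ec; case: c h0 h1 {ec} => b [] //=.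
  rewrite /cut_lt /= !andbF !orbF => b0 bi _.
  by apply: map_f; rewrite mem_iota; lia.
have := count_predC op (iota 1 M); rewrite size_iota => cM.
apply: (@leq_trans (2 * count (predC op) (iota 1 M))).
  by move: cnt cM; rewrite /M; lia.
rewrite -sum1_count big_mkcond big_distrr /=.
rewrite [X in X <= _]big_seq [X in _ <= X]big_seq.
apply: leq_sum => a; rewrite mem_iota => aM.
case: ifP => //=; rewrite negbK => cl.
move: ((_, _) :: u2) ev => v2 ev; rewrite ev toggles_cat.
have o1 := odd_toggles u1 (a, None).
have o2 := odd_toggles v2 (acts u1 (a, None)).
rewrite -acts_cat -ev pocket_acts_open in o2; last by lia.
rewrite cl /= in o1 o2; move: o1 o2; case: (toggles u1 _) => [//|x1] _.
by case: (toggles v2 _) => [//|x2] _; lia.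
Qed.

Lemma pocket_lower : 2 * K + 1 + 2 * (r * L) <= size v.
Proof.
pose s := [seq (a, None : option (seq bool)) | a <- iota 1 M].
pose s' := [seq (a, Some (nseq j false)) | a <- iota 0 r, j <- iota 0 L].
have us : uniq (s ++ (M.+1, None) :: s').
  rewrite cat_uniq cons_uniq; apply/and4P; split.
  - by rewrite map_inj_uniq ?iota_uniq // => a b [].
  - apply/hasPn => c; rewrite inE => /orP[/eqP->|/allpairsP[[a j] [_ _ ->]]].
      by apply/mapP => -[a]; rewrite mem_iota => ? [?]; lia.
    by apply/mapP => -[].
  - by apply/allpairsP => -[[a j] [_ _]].
  - apply: allpairs_uniq; rewrite ?iota_uniq //.
    by move=> [a j] [b l] _ _ /= [-> /(congr1 size)]; rewrite !size_nseq => ->.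
apply: leq_trans (sum_toggles v us); rewrite big_cat big_cons -addnA.
apply: leq_add; first by rewrite big_map; exact: pocket_toggles_open.
apply: leq_add.
  have := odd_toggles v (M.+1, None); rewrite pocket_acts_last.
  by case: (toggles _ _).
have -> : (r * L)%N = size s' by rewrite size_allpairs !size_iota.
rewrite -sum1_size big_distrr /= [X in X <= _]big_seq [X in _ <= X]big_seq.
apply: leq_sum => c /allpairsP[[a j] [ar jL ->]] /=; rewrite muln1.
rewrite !mem_iota /= in ar jL.
have -> : nseq j false = caret_addr (left_comb L) (L - j).
  by rewrite caret_addr_left_comb; [congr nseq; lia | lia].
by apply: pocket_toggles_closed; lia.
Qed.

End LowerBound.

(** * Pockets *)

(** A letter moves a gap by at most one tree. *)
Lemma acts_growth v c : (acts v c).1 <= c.1 + size v.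
Proof.
elim: v c => [|[i b] v IH] c /=; first by rewrite addn0.
apply: leq_trans (IH _) _; rewrite addnS -addSn leq_add2r.
case: c => a s; case: b; rewrite /act /=.
  by rewrite /split_at; case: ltngtP => //= ->; case: s => [[|[] u]|] /=.
case: ltnP => //= ia; case: ltnP => /= _; first by lia.
by case: s => [u|]; [|case: eqP] => /=; lia.
Qed.

Lemma length_x0_power m (v : word nat) :
  eval v = pos (nseq m 0) -> m <= size v.
Proof.
move=> ev; have := acts_growth v (1%N, None).
have step c a : 0 < a -> splits (nseq c 0%N) (a, None) = (a + c, None)%N.
  elim: c a => [|c IH] a a0 /=; first by rewrite addn0.
  by rewrite splits_cons split_gt // IH // addSnnS.
have e : acts v =1 splits (nseq m 0%N).
  by apply: acts_eval; rewrite ev -eval_pos.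
by rewrite e step.
Qed.

Theorem theorem7p1 (k n : nat) (k_ge1 : 1 <= k) (n_ge : 2 * k + 2 <= n) :
  exists (w : thompsonF) (d : nat), k <= d /\ is_pocket (thompson_X n) d w.
Proof.
(* The leaves of t have depth at least k, and rdepth t = k + 1.  With more than
   n + 2k combs, k letters cannot reach beyond the last one. *)
pose t := deep_tree k.-1; pose L := carets t; pose K := (n + 2 * k).+1.
pose w := pocket n K K (left_comb L) t; pose m := (2 * K + 1 + 2 * (K * L))%N.
have up v : all (fun a => a.1 <= n) v -> size v <= k ->
    within n (w * eval v) m.
  have := @pocket_upper n k K K (left_comb L) t v.
  rewrite carets_left_comb; apply.
  - by lia.
  - by [].
  - by have := rdepth_left_comb L; lia.
  - by rewrite rdepth_deep_tree; lia.
  - by rewrite depth_deep_tree; lia.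
  - by rewrite /K; lia.
have low v : all (fun a => a.1 <= n) v -> eval v = w -> m <= size v.
  by move=> vn vw; apply: (@pocket_lower n K K k.-1) => //; rewrite leq_addl.
have wm : word_length (thompson_X n) w m.
  split=> [|p /spells_eval[v [vn vw <-]]]; last exact: low.
  have [v [vn vw vm]] := up [::] isT (leq0n k).
  rewrite {2}/eval big_nil mulg1 in vw.
  exists [seq letter a | a <- v]; first by rewrite -vw; exact: eval_spells.
  by apply/eqP; rewrite size_map eqn_leq vm low.
pose inside d :=
  `[< ball (thompson_X n) w d `<=` ball (thompson_X n) 1 m >]%classic.
have inside_k : inside k.
  apply/asboolP => g /ballP[v [vn vg vk]]; apply/ballP.
  by rewrite invg1 mul1g -[g](mulVKg w) -vg; exact: up.
have inside_bound d : inside d -> d <= 2 * m.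
  move=> /asboolP sub; rewrite leqNgt; apply/negP => md.
  pose g := pos (nseq m.+1 0%N).
  have gn : within n g m.+1.
    have := @within_pos n (nseq m.+1 0%N).
    by rewrite all_nseq orbT size_nseq; apply.
  have /sub/ballP : ball (thompson_X n) w d g.
    apply/ballP; apply: within_leq md _; rewrite mul2n -addnn -addnS.
    apply: withinM gn; apply: withinV.
    by have := up [::] isT (leq0n k); rewrite /eval big_nil mulg1.
  rewrite invg1 mul1g => -[v [_ vg vm]].
  by have := length_x0_power vg; rewrite ltnNge vm.
case: (ex_maxnP (ex_intro _ k inside_k) inside_bound) => d /asboolP dw dmax.
exists w, d; split; first exact: dmax.
by exists m; split=> // k' k'w; apply: dmax; apply/asboolP.
Qed.
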